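(* Let $n>2$ and let $B\subset\mathbb{R}^n$ be a centrally symmetric convex body such that every non-empty closed convex subset of $B$ is parkable in $B$. Then, for every linear hyperplane $H\subset\mathbb{R}^n$, each of the non-empty intersections $(H+x)\cap B$, $x\in\mathbb{R}^n$, has a center of symmetry. Moreover, for each fixed $H$, these centers of symmetry (as $x$ varies) are collinear.
   Context: A convex body is a compact convex set with non-empty interior which contains $0$. Let $C\subseteq B$ be convex subsets of $\mathbb{R}^n$ with $0\in B$. $C$ is parkable in $B$ if there is $v\in\mathbb{R}^n$ with $0\in C+v\subseteq B$. A center of symmetry for a convex set $C\subseteq\mathbb{R}^n$ is a point $p\in C$ such that $C=2p-C:=\{2p-x\mid x\in C\}$. $C$ is centrally symmetric if $0\in C$ and $0$ is a center of symmetry for $C$ (so $C=-C$). *)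

(* Defs.v *)
From HB Require Import structures.
From mathcomp Require Import all_boot all_order all_algebra.
From mathcomp Require Import all_classical all_reals all_analysis.

Set Implicit Arguments.
Unset Strict Implicit.
Unset Printing Implicit Defensive.

Import Order.TTheory GRing.Theory Num.Theory.
Import numFieldNormedType.Exports.

Local Open Scope classical_set_scope.
Local Open Scope ring_scope.

Section ConvexGeometry.
Context {R : realType} {n : nat}.
Implicit Types (A B C S : set 'rV[R]_n) (H : {vspace 'rV[R]_n}).
Implicit Types p v x : 'rV[R]_n.

Definition translate v A : set 'rV[R]_n := [set a + v | a in A].

(* The requirement that the body contain the origin is part of the notion. *)
Definition convex_body B : Prop :=
  [/\ compact B, convex_set B, interior B !=set0 & B 0].

(* Meant for convex C `<=` B with B 0. *)
Definition parkable B C : Prop :=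
  exists v, translate v C 0 /\ translate v C `<=` B.

Definition center_of_symmetry C p : Prop :=
  C p /\ C = [set p *+ 2 - x | x in C].

Definition centrally_symmetric C : Prop := C 0 /\ center_of_symmetry C 0.

Definition linear_hyperplane H : Prop := \dim H = n.-1.

Definition hyperplane_section H B x : set 'rV[R]_n :=
  translate x [set h | h \in H] `&` B.

(* Contained in some affine line. *)
Definition collinear S : Prop :=
  exists a d : 'rV[R]_n, d != 0 /\ S `<=` [set a + t *: d | t in [set: R]].

End ConvexGeometry.

(* Main.v *)
Require Import Defs.
From HB Require Import structures.
From mathcomp Require Import all_boot all_order all_algebra.
From mathcomp Require Import all_classical all_reals all_analysis.
From mathcomp Require Import ring lra.

Set Implicit Arguments.
Unset Strict Implicit.
Unset Printing Implicit Defensive.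

Import Order.TTheory GRing.Theory Num.Theory.
Import numFieldNormedType.Exports.

Local Open Scope classical_set_scope.
Local Open Scope ring_scope.

(* Let H = ker f, let p maximize f on B, put T = f(p), and let B_t be the
   section f = t.  For a linear form w, let [a, b] join the two faces of B_t on
   which w is extremal.  If w is wider on B_t than on all higher sections, a
   parked translate of the triangle (a, b, -p) must keep its height, and 0 lies in
   this triangle for a suitable choice of a and b: so some affine diameter of B_t
   in the direction of w passes through (t / T) p.  A theorem of Hammer then
   makes (t / T) p the center of B_t: the ratio h(w) / h(-w) of values of the
   support function based at this point has zero derivative, hence is constant on
   the connected set of non-zero forms on H (this is where n > 2 is used), hence
   is 1. *)

(** * Inner product of row vectors, and topological preliminaries *)

Definition dot (R : realType) n (u v : 'rV[R]_n) : R := (u *m v^T) 0 0.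

Section Dot.
Variables (R : realType) (n : nat).
Implicit Types u v w : 'rV[R]_n.

Lemma dotE u v : dot u v = \sum_i u 0 i * v 0 i.
Proof. by rewrite /dot mxE; apply: eq_bigr => i _; rewrite mxE. Qed.

Lemma dotC u v : dot u v = dot v u.
Proof. by rewrite !dotE; apply: eq_bigr => i _; rewrite mulrC. Qed.

Lemma dotDl u v w : dot (u + v) w = dot u w + dot v w.
Proof. by rewrite /dot mulmxDl mxE. Qed.

Lemma dotNl u v : dot (- u) v = - dot u v.
Proof. by rewrite /dot mulNmx mxE. Qed.

Lemma dotZl k u v : dot (k *: u) v = k * dot u v.
Proof. by rewrite /dot -scalemxAl mxE. Qed.

Lemma dotDr u v w : dot w (u + v) = dot w u + dot w v.
Proof. by rewrite !(dotC w) dotDl. Qed.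

Lemma dotNr u v : dot u (- v) = - dot u v.
Proof. by rewrite !(dotC u) dotNl. Qed.

Lemma dotZr k u v : dot u (k *: v) = k * dot u v.
Proof. by rewrite !(dotC u) dotZl. Qed.

Lemma dot0l u : dot 0 u = 0.
Proof. by rewrite -(scale0r u) dotZl mul0r. Qed.

Definition dot_lin :=
  (dotDl, dotDr, dotNl, dotNr, dotZl, dotZr, dot0l).

Lemma dot_ge0 u : 0 <= dot u u.
Proof. by rewrite dotE sumr_ge0 // => i _; rewrite -expr2 sqr_ge0. Qed.

Lemma dot_eq0 u : (dot u u == 0) = (u == 0).
Proof.
apply/idP/eqP => [|->]; last by rewrite dot0l.
rewrite dotE psumr_eq0 => [/allP u0|i _]; last by rewrite -expr2 sqr_ge0.
apply/rowP => i; rewrite mxE; apply/eqP.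
by have := u0 i (mem_index_enum i); rewrite mulf_eq0 orbb.
Qed.

Lemma dot_gt0 u : (0 < dot u u) = (u != 0).
Proof. by rewrite lt_def dot_ge0 dot_eq0 andbT. Qed.

Lemma continuous_dot (T : topologicalType) (f g : T -> 'rV[R]_n) :
  continuous f -> continuous g -> continuous (fun x => dot (f x) (g x)).
Proof.
move=> cf cg x.
rewrite (_ : (fun x => _) = fun x => \sum_i f x 0 i * g x 0 i); last first.
  by apply/funext => y; rewrite dotE.
apply: cvg_big => [|i _].
  by move=> y; exact: (@add_continuous R).
apply: cvgM.
  by apply: (cvg_comp _ (fun M : 'rV[R]_n => M 0 i) (cf x)); exact: coord_continuous.
by apply: (cvg_comp _ (fun M : 'rV[R]_n => M 0 i) (cg x)); exact: coord_continuous.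
Qed.

Lemma continuous_dotr u : continuous (fun x : 'rV[R]_n => dot u x).
Proof.
apply: (@continuous_dot _ (fun=> u) id); first exact: cst_continuous.
by move=> x; exact: cvg_id.
Qed.

Lemma convex_setP (A : set 'rV[R]_n) :
  convex_set A <-> forall x y s, A x -> A y -> 0 <= s -> s <= 1 ->
    A (s *: x + (1 - s) *: y).
Proof.
split=> [cA x y s Ax Ay s0 s1|cA x y s].
  have s01 : Itv.spec (@Itv.num_sem R) (Itv.Real `[0, 1]%Z) s.
    by rewrite /= /Itv.num_sem /= in_itv /= s0 s1 num_real.
  have /set_mem := cA x y (Itv.mk s01) (mem_set Ax) (mem_set Ay).
  by [].
move=> /set_mem Ax /set_mem Ay; apply/mem_set; apply: cA => //.
Qed.

Lemma closed_preimage (T U : topologicalType) (g : T -> U) (D : set U) :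
  continuous g -> closed D -> closed (g @^-1` D).
Proof. by move=> cg cD; apply: preimage_closed => // x _; exact: cg. Qed.

Lemma closed_le_fun (T : topologicalType) (g h : T -> R) :
  continuous g -> continuous h -> closed [set x | g x <= h x].
Proof.
move=> cg ch; rewrite (_ : mkset _ = (fun x => h x - g x) @^-1` [set y | 0 <= y]).
  apply: closed_preimage; last exact: closed_ge.
  by move=> x; apply: cvgB; [exact: ch|exact: cg].
by apply/seteqP; split=> x /=; rewrite subr_ge0.
Qed.

Lemma closed_eq_fun (T : topologicalType) (g h : T -> R) :
  continuous g -> continuous h -> closed [set x | g x = h x].
Proof.
move=> cg ch; rewrite (_ : mkset _ = (fun x => h x - g x) @^-1` [set y | y = 0]).
  apply: closed_preimage; last exact: closed_eq.
  by move=> x; apply: cvgB; [exact: ch|exact: cg].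
by apply/seteqP; split=> x /= => [->|/eqP]; rewrite ?subrr// subr_eq0 => /eqP.
Qed.

Lemma rV_compact_closed (A : set 'rV[R]_n) : compact A -> closed A.
Proof. by apply: compact_closed; exact: norm_hausdorff. Qed.

Lemma compact_max (T : topologicalType) (g : T -> R) (A : set T) :
  A !=set0 -> compact A -> continuous g ->
  exists c, A c /\ forall x, A x -> g x <= g c.
Proof.
move=> A0 cA cg; have [|c /set_mem Ac cM] := compact_EVT_max A0 cA (f := g).
  exact: continuous_subspaceT.
by exists c; split=> // x Ax; apply: cM; exact: mem_set.
Qed.

Lemma compact_min (T : topologicalType) (g : T -> R) (A : set T) :
  A !=set0 -> compact A -> continuous g ->
  exists c, A c /\ forall x, A x -> g c <= g x.
Proof.
move=> A0 cA cg; have [|c /set_mem Ac cM] := compact_EVT_min A0 cA (f := g).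
  exact: continuous_subspaceT.
by exists c; split=> // x Ax; apply: cM; exact: mem_set.
Qed.

Lemma continuous_subl (T : topologicalType) (g : T -> 'rV[R]_n) u :
  continuous g -> continuous (fun x => u - g x).
Proof. by move=> cg x; apply: cvgB; [exact: cvg_cst|exact: cg]. Qed.

End Dot.

(** * Triangles in barycentric coordinates *)

Section Triangle.
Variables (R : realType) (n : nat).
Implicit Types a b d x y : 'rV[R]_n.

(** Explicit weights rather than a convex hull: those of the parked point enter the estimate in
    [highest_chord]. *)
Definition triangle a b d : set 'rV[R]_n :=
  [set x | exists l m : R, [/\ 0 <= l, 0 <= m, l + m <= 1 &
     x = l *: a + m *: b + (1 - l - m) *: d]].

Lemma continuous_fst (T U : topologicalType) : continuous (@fst T U).
Proof. by move=> x; exact: cvg_fst. Qed.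

Lemma continuous_snd (T U : topologicalType) : continuous (@snd T U).
Proof. by move=> x; exact: cvg_snd. Qed.

Lemma triangle_compact a b d : compact (triangle a b d).
Proof.
pose S := [set p : R * R | [/\ 0 <= p.1, 0 <= p.2 & p.1 + p.2 <= 1]].
have c1 := @continuous_fst R R; have c2 := @continuous_snd R R.
have cS : compact S.
  apply: (@subclosed_compact _ S (`[0, 1] `*` `[0, 1])).
  - rewrite (_ : S = [set p | 0 <= p.1] `&` ([set p | 0 <= p.2] `&`
      [set p | p.1 + p.2 <= 1])).
      apply: closedI; first by apply: closed_le_fun => // x; exact: cvg_cst.
      apply: closedI; apply: closed_le_fun => //; try by move=> x; exact: cvg_cst.
      by move=> x; apply: cvgD; [exact: c1|exact: c2].
    by apply/seteqP; split=> [x []|x [? []]].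
  - by apply: compact_setX; exact: segment_compact.
  - by move=> [l m] [/= l0 m0 lm]; rewrite /= !in_itv /=; split; lra.
rewrite (_ : triangle a b d =
    (fun p : R * R => p.1 *: a + p.2 *: b + (1 - p.1 - p.2) *: d) @` S).
  apply: continuous_compact => //; apply: continuous_subspaceT => x.
  apply: cvgD; [apply: cvgD|]; (apply: cvgZ; last exact: cvg_cst).
  - exact: c1.
  - exact: c2.
  by apply: cvgB; [apply: cvgB; [exact: cvg_cst|exact: c1]|exact: c2].
apply/seteqP; split => x.
  by move=> [l [m [l0 m0 lm ->]]]; exists (l, m).
by move=> [[l m] [/= l0 m0 lm] <-]; exists l, m.
Qed.

Lemma triangle_convex a b d : convex_set (triangle a b d).
Proof.
apply/convex_setP => x y s [l [m [l0 m0 lm ->]]] [l' [m' [l0' m0' lm' ->]]] s0 s1.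
exists (s * l + (1 - s) * l'), (s * m + (1 - s) * m'); split; [nra|nra|nra|].
by apply/rowP => i; rewrite !mxE; ring.
Qed.

Lemma triangle_sub (B : set 'rV[R]_n) a b d :
  convex_set B -> B a -> B b -> B d -> triangle a b d `<=` B.
Proof.
move=> /convex_setP cB Ba Bb Bd x [l [m [l0 m0 lm ->]]].
have [k0|k0] := eqVneq (l + m) 0.
  have -> : l = 0 by lra.
  have -> : m = 0 by lra.
  by rewrite !scale0r !add0r !subr0 scale1r.
have {}k0 : 0 < l + m by rewrite lt_def k0; lra.
have := cB a b (l / (l + m)) Ba Bb; rewrite divr_ge0 ?(ltW k0)//.
rewrite ler_pdivrMr // mul1r lerDl => /(_ isT m0) Be.
have := cB _ d (l + m) Be Bd (ltW k0) lm.
congr (B _); apply/rowP => i; rewrite !mxE; field; lra.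
Qed.

End Triangle.

(** * Chords of a symmetric body in which triangles can be parked *)

Section Chord.
Variables (R : realType) (n : nat) (B : set 'rV[R]_n).
Hypotheses (Bcompact : compact B) (Bconvex : convex_set B).
Hypothesis Bopp : forall x, B x -> B (- x).
Hypothesis Bpark : forall C : set 'rV[R]_n,
  C !=set0 -> closed C -> convex_set C -> C `<=` B -> parkable B C.

(** The point of the triangle that is sent to 0 is named [c], so the parking translation is by
    [- c]. *)
Lemma park_triangle a b d : B a -> B b -> B d ->
  exists c, [/\ triangle a b d c, B (a - c), B (b - c) & B (d - c)].
Proof.
move=> Ba Bb Bd.
have Ta : triangle a b d a.
  by exists 1, 0; split; [lra|lra|lra|apply/rowP => i; rewrite !mxE; ring].
have Tb : triangle a b d b.
  by exists 0, 1; split; [lra|lra|lra|apply/rowP => i; rewrite !mxE; ring].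
have Td : triangle a b d d.
  by exists 0, 0; split; [lra|lra|lra|apply/rowP => i; rewrite !mxE; ring].
have [||||v [[c Tc cv] sub]] := Bpark (C := triangle a b d).
- by exists a.
- by apply: rV_compact_closed; exact: triangle_compact.
- exact: triangle_convex.
- exact: triangle_sub.
have vE : v = - c by apply/eqP; rewrite -addr_eq0 addrC cv.
by exists c; split=> //; apply: sub; rewrite vE; [exists a|exists b|exists d].
Qed.

Variables (f w p : 'rV[R]_n).
Hypotheses (Bp : B p) (pmax : forall x, B x -> dot f x <= dot f p).

Let T := dot f p.

Let chords (W : R) : set ('rV[R]_n * 'rV[R]_n) :=
  (B `*` B) `&` ([set x | dot f x.1 = dot f x.2] `&`
                 [set x | W <= dot w x.1 - dot w x.2]).

Let continuous_dotl (S : topologicalType) u (g : S -> 'rV[R]_n) :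
  continuous g -> continuous (fun x => dot u (g x)).
Proof. by move=> cg; apply: continuous_dot => // x; exact: cvg_cst. Qed.

Let chords_compact W : compact (chords W).
Proof.
have c1 := @continuous_fst 'rV[R]_n 'rV[R]_n.
have c2 := @continuous_snd 'rV[R]_n 'rV[R]_n.
apply: compact_closedI; first exact: compact_setX.
apply: closedI; first by apply: closed_eq_fun; [exact: (continuous_dotl c1)|exact: (continuous_dotl c2)].
apply: closed_le_fun; first by move=> x; exact: cvg_cst.
by move=> x; apply: cvgB; [exact: (continuous_dotl c1)|exact: (continuous_dotl c2)].
Qed.

(* Among the chords of maximal height t0, take one passing as close as possible
   to (t0 / T) p. If it missed that point, parking the triangle (a, b, -p)
   would keep the height and bring the chord closer. *)
Lemma highest_chord (W : R) a1 b1 :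
  B a1 -> B b1 -> dot f a1 = dot f b1 -> 0 < dot f a1 -> W <= dot w a1 - dot w b1 ->
  exists (a b : 'rV[R]_n) (s : R), [/\ chords W (a, b), dot f a1 <= dot f a, 0 <= s, s <= 1 &
    s *: a + (1 - s) *: b = (dot f a / T) *: p].
Proof.
move=> Ba1 Bb1 fab1 fa1 W1.
have [||[a0 b0] [/= ch0 max0]] := compact_max _ (@chords_compact W)
    (g := fun x => dot f x.1).
- by exists (a1, b1).
- by apply: continuous_dotl; exact: continuous_fst.
set t0 := dot f a0 in max0.
have t1 : dot f a1 <= t0 by exact: (max0 (a1, b1)).
have t0T : t0 <= T by apply: pmax; case: ch0 => -[].
have T0 : 0 < T by lra.
pose q0 := (t0 / T) *: p.
(* [S] adds a parameter to a chord of maximal height [t0]; [m] is the offset from [q0] of the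
   corresponding point of the chord. *)
pose S : set (('rV[R]_n * 'rV[R]_n) * R) :=
  (chords W `*` `[0, 1]) `&` [set x | dot f x.1.1 = t0].
pose m (x : ('rV[R]_n * 'rV[R]_n) * R) := x.2 *: x.1.1 + (1 - x.2) *: x.1.2 - q0.
have c1 : continuous (fun x : ('rV[R]_n * 'rV[R]_n) * R => x.1.1).
  by move=> x; apply: (cvg_comp _ fst (@continuous_fst _ _ x)); exact: continuous_fst.
have c2 : continuous (fun x : ('rV[R]_n * 'rV[R]_n) * R => x.1.2).
  by move=> x; apply: (cvg_comp _ snd (@continuous_fst _ _ x)); exact: continuous_snd.
have c3 := @continuous_snd ('rV[R]_n * 'rV[R]_n)%type R.
have cm : continuous m.
  move=> x; apply: cvgB; last exact: cvg_cst.
  apply: cvgD; apply: cvgZ; [exact: c3|exact: c1| |exact: c2].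
  by apply: cvgB; [exact: cvg_cst|exact: c3].
have [|||[[a b] s] [[[ch /= s01] fa] min]] := @compact_min _ _ (fun x => dot (m x) (m x)) S.
- by exists ((a0, b0), 0); split=> //; split=> //=; rewrite in_itv /= lexx ler01.
- apply: compact_closedI; first by apply: compact_setX => //; exact: segment_compact.
  by apply: closed_eq_fun; [exact: (continuous_dotl c1)|move=> x; exact: cvg_cst].
- exact: continuous_dot.
move: s01; rewrite in_itv /= => /andP[s0 s1].
have [[/= Ba Bb] [/= fab Wab]] := ch.
exists a, b, s; split=> //; first by rewrite fa.
suff /eqP : dot (m ((a, b), s)) (m ((a, b), s)) = 0.
  by rewrite dot_eq0 subr_eq0 fa => /eqP.
have [c [[l [k [l0 k0 lk cE]]] Bac Bbc Bpc]] := park_triangle Ba Bb (Bopp Bp).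
have chc : chords W (a - c, b - c).
  by split=> //; split=> /=; rewrite !dot_lin; lra.
(* The parked chord is no higher than [t0], so [dot f c] >= 0; with [- p - c] also [p + c] lies in
   [B], so [dot f c] <= 0. *)
have fc : dot f c = 0.
  have := pmax (Bopp Bpc); have := max0 _ chc; rewrite /= !dot_lin.
  move: fa => /= ->; lra.
have lkE : (l + k) * t0 = (1 - l - k) * T.
  by move: fc; rewrite cE !dot_lin -fab -/T; move: fa => /= ->; lra.
(* On the parked chord this parameter absorbs the weights [l] and [k] of [c], and [lkE] turns the
   remaining multiple of [p] into one of [q0]: the offset shrinks by the factor 1 - (l + k). *)
pose s' := (1 - (l + k)) * s + l.
have S' : S ((a - c, b - c), s').
  split; last by rewrite /= !dot_lin fc; move: fa => /= ->; lra.
  by split=> //=; rewrite in_itv /= /s'; apply/andP; split; nra.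
have mE : m ((a - c, b - c), s') = (1 - (l + k)) *: m ((a, b), s).
  rewrite /m /= cE /s' /q0.
  have -> : t0 / T *: p = t0 *: (T^-1 *: p) by rewrite scalerA.
  have -> : p = T *: (T^-1 *: p) by rewrite scalerA mulfV ?scale1r //; lra.
  set p' := T^-1 *: p.
  have -> : T^-1 *: (T *: p') = p' by rewrite scalerA mulVf ?scale1r //; lra.
  clearbody p'; apply/rowP => i; rewrite !mxE.
  have E : (1 - l - k) * T * p' 0 i - (l + k) * t0 * p' 0 i = 0 by rewrite lkE subrr.
  by rewrite -[RHS]addr0 -E; ring.
have := min _ S'; rewrite mE dotZl dotZr.
have lk0 : 0 < l + k.
  rewrite lt_def addr_ge0 // andbT; apply/eqP => lk0; move: lkE.
  by rewrite -addrA -opprD lk0 mul0r subr0; lra.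
have := dot_ge0 (m ((a, b), s)); set D := dot _ _ => D0 DD.
(* This is 1 - (1 - (l + k))^2, from comparing the squared offsets. *)
have lk2 : 0 < (l + k) * (2 - (l + k)) by rewrite mulr_gt0 //; lra.
by apply/eqP; rewrite eq_le D0 andbT -(pmulr_rle0 _ lk2); lra.
Qed.

(** The full width of level [t] is fed to [highest_chord], which may answer at a larger height; once
    moved back to level [t], a chord that wide must have extremal ends. *)
Lemma extremal_chord (t : R) : 0 < t -> t <= T ->
  exists (a b : 'rV[R]_n) (s : R), [/\ 0 <= s, s <= 1, s *: a + (1 - s) *: b = (t / T) *: p,
    (B a /\ dot f a = t /\ forall x, B x -> dot f x = t -> dot w x <= dot w a) &
    (B b /\ dot f b = t /\ forall x, B x -> dot f x = t -> dot w b <= dot w x)].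
Proof.
move=> t0 tT.
have T0 : 0 < T by lra.
have B0 : B 0.
  have -> : 0 = 2^-1 *: p + (1 - 2^-1) *: (- p).
    by apply/rowP => i; rewrite !mxE; lra.
  by apply: (convex_setP _).1 => //; [exact: Bopp|lra].
pose D := B `&` [set x | dot f x = t].
have D0 : D !=set0.
  exists ((t / T) *: p); split; last by rewrite /= dot_lin -/T; field; lra.
  rewrite -[_ *: p]addr0 -(scaler0 _ (1 - t / T)).
  apply: (convex_setP _).1 => //; first by rewrite divr_ge0//; lra.
  by rewrite ler_pdivrMr // mul1r.
have cD : compact D.
  apply: compact_closedI => //.
  by apply: closed_eq_fun; [exact: continuous_dotr|exact: cst_continuous].
have [a1 [[Ba1 fa1] maxa]] := compact_max D0 cD (@continuous_dotr _ _ w).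
have [b1 [[Bb1 fb1] minb]] := compact_min D0 cD (@continuous_dotr _ _ w).
rewrite /= in fa1 fb1.
have [||a [b [s [[[/= Ba Bb] [/= fab Wab]] ta s0 s1 sE]]]] :=
  @highest_chord (dot w a1 - dot w b1) a1 b1 Ba1 Bb1 _ _ (lexx _).
- by rewrite fa1 fb1.
- by rewrite fa1.
rewrite fa1 in ta; set t' := dot f a in ta sE *.
(* Moving the chord [a, b] from height t' down to height t, towards the parallel
   chord [-d, d] of the same length, keeps its width in the direction w. *)
pose u := t / t'.
have ut' : u * t' = t by rewrite /u; field; lra.
have u0 : 0 <= u by rewrite divr_ge0//; lra.
have u1 : u <= 1 by rewrite ler_pdivrMr; lra.
pose d := 2^-1 *: a + (1 - 2^-1) *: (- b).
have Bd : B d by apply: (convex_setP _).1 => //; [exact: Bopp|lra].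
have Ba' : B (u *: a + (1 - u) *: d) by apply: (convex_setP _).1.
have Bb' : B (u *: b + (1 - u) *: (- d)).
  by apply: (convex_setP _).1 => //; exact: Bopp.
have fa' : dot f (u *: a + (1 - u) *: d) = t.
  by rewrite !dot_lin -fab -/t' -ut'; field.
have fb' : dot f (u *: b + (1 - u) *: (- d)) = t.
  by rewrite !dot_lin -fab -/t' -ut'; field.
have wa := maxa _ (conj Ba' fa'); have wb := minb _ (conj Bb' fb').
rewrite !dot_lin in wa wb.
(* The parameters [s] on [a, b] and 1/2 on [d, -d], whose midpoint is 0, are mixed with weights [u]
   and [1 - u]; this gives [u] times the point on [a, b]. *)
exists (u *: a + (1 - u) *: d), (u *: b + (1 - u) *: (- d)), (u * s + (1 - u) / 2).
split; [nra|nra| | |].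
- have -> : (t / T) *: p = u *: ((t' / T) *: p).
    by rewrite scalerA; congr (_ *: _); rewrite -ut' mulrA.
  by rewrite -sE; apply/rowP => i; rewrite !mxE; field.
- split=> //; split=> // x Bx fx; have := maxa x (conj Bx fx).
  by rewrite !dot_lin; lra.
- split=> //; split=> // x Bx fx; have := minb x (conj Bx fx).
  by rewrite !dot_lin; lra.
Qed.

End Chord.

(** * Ratio of two support functions along a segment of forms *)

Section SupportRatio.
Variables (R : realType) (n : nat) (X Y : 'rV[R]_n -> 'rV[R]_n).
Implicit Types u v w : 'rV[R]_n.
Hypothesis Xmax : forall w u, dot w (X u) <= dot w (X w).
Hypothesis Ymax : forall w u, dot w (Y u) <= dot w (Y w).
Hypothesis XY : forall w, dot w (Y w) *: X w = dot w (X w) *: Y w.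

(** In the application [X] and [Y] give contact points of D - q and q - D, for a convex set D and a
    point q; then [h] and [g] are their support functions and g(w) = h(-w). *)
Let h w := dot w (X w).
Let g w := dot w (Y w).

(** The two maximality inequalities are added: subgradients of the convex function [g] are
    monotone. *)
Let Y_monotone w v (e : R) : 0 < e -> dot v (Y w) <= dot v (Y (w + e *: v)).
Proof.
move=> e0; have := Ymax w (w + e *: v); have := Ymax (w + e *: v) w.
by rewrite !dot_lin => A C; rewrite -(ler_pM2l e0); lra.
Qed.

(** [X w] and [Y w] are subgradients of [h] and [g], and [XY] puts their values on [v] in the ratio
    of [h] to [g]: the first-order terms of the quotient cancel, leaving the variation of
    [dot v (Y _)]. *)
Lemma support_ratio_step w v (e m M : R) : 0 < e -> 0 < m ->
  m <= g w -> m <= g (w + e *: v) -> 0 <= h w -> h w <= M ->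
  h w / g w - e * (M / m ^+ 2) * (dot v (Y (w + e *: v)) - dot v (Y w))
    <= h (w + e *: v) / g (w + e *: v).
Proof.
move=> e0 m0; have := Y_monotone w v e0.
have := Xmax (w + e *: v) w; have := Ymax w (w + e *: v).
have : g w * dot v (X w) = h w * dot v (Y w).
  by rewrite -!dotZr XY.
have gE : g (w + e *: v) = dot w (Y (w + e *: v)) + e * dot v (Y (w + e *: v)).
  by rewrite /g !dot_lin.
have -> : dot (w + e *: v) (X w) = h w + e * dot v (X w) by rewrite !dot_lin.
rewrite -/(h _) -/(g _).
move: gE; set h1 := h w; set h2 := h _; set g1 := g w; set g2 := g _.
set a := dot v (X w); set y1 := dot v (Y w); set y2 := dot v (Y _).
set b := dot w (Y _) => gE E1 bg1 ah2 y12 mg1 mg2 h10 h1M.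
have g10 : 0 < g1 by lra.
have g20 : 0 < g2 by lra.
have M0 : 0 <= M by lra.
rewrite lerBlDr -lerBlDl.
have -> : h1 / g1 - h2 / g2 = (h1 * g2 - h2 * g1) / (g1 * g2) by field; lra.
have key : h1 * g2 - h2 * g1 <= e * M * (y2 - y1).
  have h2g1 : (h1 + e * a) * g1 <= h2 * g1 by rewrite ler_pM2r.
  have h1g2 : h1 * g2 <= h1 * (g1 + e * y2) by rewrite ler_wpM2l // gE; lra.
  have hM : h1 * (e * (y2 - y1)) <= M * (e * (y2 - y1)).
    by rewrite ler_wpM2r // mulr_ge0 ?subr_ge0 // ltW.
  have : e * (g1 * a) = e * (h1 * y1) by rewrite E1.
  lra.
rewrite ler_pdivrMr; last exact: mulr_gt0.
apply: (le_trans key).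
have mg : m ^+ 2 <= g1 * g2 by rewrite expr2 ler_pM // ltW.
have -> : e * (M / m ^+ 2) * (y2 - y1) * (g1 * g2) =
  e * M * (y2 - y1) * (g1 * g2 / m ^+ 2) by field; lra.
rewrite ler_peMr //; first by rewrite !mulr_ge0 // ?subr_ge0 // ltW.
by rewrite ler_pdivlMr ?exprn_gt0 // mul1r.
Qed.

(* Subdivide the segment into N pieces: the errors in support_ratio_step
   telescope, because v.Y is monotone along the segment, and sum to O(1/N). *)
Lemma support_ratio_le w0 w1 (m : R) : 0 < m ->
  (forall s : R, 0 <= s -> s <= 1 ->
     m <= h (w0 + s *: (w1 - w0)) /\ m <= g (w0 + s *: (w1 - w0))) ->
  h w0 / g w0 <= h w1 / g w1.
Proof.
move=> m0 lb; set v := w1 - w0.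
(* [h] is convex and positive at both ends, so the sum of its end values bounds it on the
   segment. *)
pose M := h w0 + h w1.
have w1E : w0 + 1 *: v = w1 by rewrite scale1r addrC subrK.
have hM s : 0 <= s -> s <= 1 -> h (w0 + s *: v) <= M.
  move=> s0 s1; have := Xmax w0 (w0 + s *: v); have := Xmax w1 (w0 + s *: v).
  have [] := lb 0; rewrite ?ler01 // scale0r addr0 => h0 _.
  have [] := lb 1; rewrite ?ler01 // w1E => h1 _.
  have -> : h (w0 + s *: v) =
    (1 - s) * dot w0 (X (w0 + s *: v)) + s * dot w1 (X (w0 + s *: v)).
    by rewrite /h /v; set x := X _; rewrite !dot_lin; ring.
  by rewrite -/(h _) -/(h _) /M; nra.
pose E := M / m ^+ 2 * (dot v (Y w1) - dot v (Y w0)).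
have E0 : 0 <= E.
  have := Y_monotone w0 v ltr01; rewrite w1E => y01.
  rewrite mulr_ge0 ?subr_ge0 // divr_ge0 ?sqr_ge0 //.
  by have := hM 0 (lexx _) ler01; have [] := lb 0 (lexx _) ler01; rewrite -/v; lra.
have bound (N : nat) : h w0 / g w0 - E / N.+1%:R <= h w1 / g w1.
  pose e : R := N.+1%:R^-1.
  have e0 : 0 < e by rewrite invr_gt0.
  have eN : e * N.+1%:R = 1 by rewrite mulVf.
  have step (i : nat) : (i <= N.+1)%N ->
    h w0 / g w0 - e * (M / m ^+ 2) * (dot v (Y (w0 + (e * i%:R) *: v)) - dot v (Y w0))
      <= h (w0 + (e * i%:R) *: v) / g (w0 + (e * i%:R) *: v).
    elim: i => [_|i IH iN]; first by rewrite mulr0 scale0r addr0 subrr mulr0 subr0.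
    have := IH (ltnW iN).
    have wE : w0 + (e * i.+1%:R) *: v = (w0 + (e * i%:R) *: v) + e *: v.
      by rewrite -addrA -scalerDl -natr1 mulrDr mulr1.
    have le1 (j : nat) : (j <= N.+1)%N -> e * j%:R <= 1.
      by move=> jN; rewrite -[leRHS]eN ler_pM2l // ler_nat.
    have ge0 (j : nat) : 0 <= e * j%:R by rewrite mulr_ge0 // ltW.
    have [hi gi] := lb _ (ge0 i) (le1 _ (ltnW iN)).
    have [hi' gi'] := lb _ (ge0 i.+1) (le1 _ iN).
    have hiM := hM _ (ge0 i) (le1 _ (ltnW iN)).
    rewrite -/v wE in hi gi hi' gi' hiM *.
    have := support_ratio_step e0 m0 gi gi' (le_trans (ltW m0) hi) hiM.
    lra.
  have -> : E / N.+1%:R = e * (M / m ^+ 2) * (dot v (Y w1) - dot v (Y w0)).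
    by rewrite /E mulrC [LHS]mulrA.
  by have := step _ (leqnn _); rewrite eN w1E => S; exact: S.
rewrite leNgt; apply/negP => lt.
pose r := h w0 / g w0 - h w1 / g w1.
have r0 : 0 < r by rewrite subr_gt0.
have := archi_boundP (divr_ge0 E0 (ltW r0)).
set N := Num.bound _ => EN.
have := bound N; rewrite lerBlDr -lerBlDl -/r => rN.
have : E < r * N.+1%:R.
  by rewrite mulrC -ltr_pdivrMr //; apply: (lt_le_trans EN); rewrite ler_nat.
by rewrite -ltr_pdivrMr // ltNge rN.
Qed.

End SupportRatio.

(** * Nearest point of a compact convex set *)

Section Separation.
Variables (R : realType) (n : nat).

Lemma dot_subZ (d e : 'rV[R]_n) (s : R) :
  dot (d - s *: e) (d - s *: e) = dot d d - 2 * s * dot d e + s * s * dot e e.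
Proof. by rewrite !dot_lin (dotC e d); ring. Qed.

(** If the angle at the nearest point [x] were acute, a move from [x] towards [z] would come closer
    to [u]. *)
Lemma nearest_point (D : set 'rV[R]_n) (u : 'rV[R]_n) :
  D !=set0 -> compact D -> convex_set D ->
  exists x, D x /\ forall z, D z -> dot (u - x) (z - x) <= 0.
Proof.
move=> D0 cD /convex_setP cvD.
have cu : continuous (fun x : 'rV[R]_n => u - x).
  by apply: (@continuous_subl _ _ _ id) => x; exact: cvg_id.
have [x [Dx min]] := compact_min D0 cD (continuous_dot cu cu).
exists x; split=> // z Dz; rewrite leNgt; apply/negP => a0.
set d := u - x in min a0; set e := z - x in a0.
have step s : 0 <= s -> s <= 1 -> 2 * s * dot d e <= s * s * dot e e.
  move=> s0 s1; have := min _ (cvD z x s Dz Dx s0 s1).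
  have -> : u - (s *: z + (1 - s) *: x) = d - s *: e.
    by apply/rowP => i; rewrite !mxE; ring.
  by rewrite dot_subZ; lra.
have e0 := dot_ge0 e; set a := dot d e in a0 step; set b := dot e e in e0 step.
(* The squared distance is quadratic in the step and least at a / b; when [b < a], the full step
   already contradicts minimality. *)
have [ab|ba] := leP a b.
  have b0 : 0 < b by lra.
  have := step (a / b); rewrite divr_ge0 ?(ltW a0) // ler_pdivrMr // mul1r.
  move=> /(_ isT ab).
  have -> : a / b * (a / b) * b = a / b * a by field; lra.
  have : 0 < a / b * a by rewrite !mulr_gt0 // invr_gt0.
  lra.
by have := step 1 ler01 (lexx _); lra.
Qed.

End Separation.

(** * Orthogonal vectors and normals of hyperplanes *)

Section LinearAlgebra.
Variables (R : realType) (n : nat).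
Implicit Types u v x : 'rV[R]_n.

Lemma exists_orthogonal m (M : 'M[R]_(m, n)) : (m < n)%N ->
  exists k : 'rV[R]_n, k != 0 /\ forall i, dot (row i M) k = 0.
Proof.
move=> mn; exists (nz_row (kermx M^T)); split.
  rewrite nz_row_eq0 -mxrank_eq0 mxrank_ker mxrank_tr subn_eq0 -ltnNge.
  exact: leq_ltn_trans (rank_leq_row M) mn.
move=> i; have /sub_kermxP k0 := nz_row_sub (kermx M^T).
have -> : dot (row i M) (nz_row (kermx M^T)) = (nz_row (kermx M^T) *m M^T) 0 i.
  by rewrite dotC dotE mxE; apply: eq_bigr => j _; rewrite !mxE.
by rewrite k0 mxE.
Qed.

(** Applied to [f] and a form [d], it gives a form through which a path from [- d] to [d] avoids
    0. *)
Lemma exists_orthogonal2 u v : (2 < n)%N ->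
  exists k : 'rV[R]_n, [/\ k != 0, dot u k = 0 & dot v k = 0].
Proof.
move=> n2; have [k [k0 kM]] := exists_orthogonal (col_mx u v) n2.
exists k; split=> //.
  by have := kM (lshift 1 0); rewrite rowKu row_id.
by have := kM (rshift 1 0); rewrite rowKd row_id.
Qed.

(** A vector [u] orthogonal to a basis of [H] works: were some [x] outside [H] also orthogonal to
    it, [H] and [x] would span the space and [u] would be orthogonal to itself. *)
Lemma hyperplane_normal (H : {vspace 'rV[R]_n}) : (0 < n)%N -> linear_hyperplane H ->
  exists u, u != 0 /\ forall x, (x \in H) = (dot u x == 0).
Proof.
move=> n0 dimH.
have dHn : (\dim H < n)%N by rewrite dimH; case: (n) n0.
have [u [u0 uM]] := exists_orthogonal (\matrix_(i < \dim H) (vbasis H)`_i) dHn.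
have Hu x : x \in H -> dot u x = 0.
  move=> /coord_vbasis ->; elim/big_ind: _ => [|y z y0 z0|i _].
  - by rewrite dotC dot0l.
  - by rewrite dotDr y0 z0 addr0.
  - by have := uM i; rewrite rowK dotC dotZr => ->; rewrite mulr0.
exists u; split=> // x; apply/idP/eqP => [/Hu//|ux].
apply/negPn/negP => xH.
have full : (fullv <= H + <[x]>)%VS.
  rewrite -(geq_leqif (dimv_leqif_sup (subvf _))).
  have : (\dim H < \dim (H + <[x]>))%N.
    rewrite ltn_neqAle dimvS ?addvSl // andbT.
    apply: contra xH => /eqP dE.
    have : (H == H + <[x]>)%VS by rewrite eqEdim addvSl -dE leqnn.
    by move=> /eqP ->; apply: (subvP (addvSr _ _)); exact: memv_line.
  by rewrite dimH prednK // dimvf /dim /= mul1n.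
have /memv_addP [y yH [z /vlineP [c ->] uE]] := subvP full u (memvf u).
have : dot u u == 0 by rewrite {2}uE dotDr Hu // dotZr ux mulr0 addr0.
by rewrite dot_eq0 (negPf u0).
Qed.

End LinearAlgebra.

(** * Hammer's theorem on affine diameters through one point *)

Section AffineDiameters.
Variables (R : realType) (n : nat).

(* For a form d separating 2q - z from D, with z in D, the support ratio is < 1
   at d and > 1 at -d, although support_ratio_le compares it at -d, k and d, for k
   orthogonal to d, along two segments of forms avoiding 0. *)
Lemma affine_diameters_center (D : set 'rV[R]_n) (q f : 'rV[R]_n) :
  (2 < n)%N -> compact D -> convex_set D -> D q ->
  (forall x, D x -> dot f x = dot f q) ->
  (forall z, dot f z = 0 -> exists c : R, [/\ 0 < c, D (q + c *: z) & D (q - c *: z)]) ->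
  (forall w, exists (a b : 'rV[R]_n) (s : R),
     [/\ D a, D b, s *: a + (1 - s) *: b = q &
         forall x, D x -> dot w b <= dot w x /\ dot w x <= dot w a]) ->
  forall x, D x -> D (q *+ 2 - x).
Proof.
move=> n2 cD cvD Dq fD intD diam z Dz; apply: contrapT => nDu.
set u := q *+ 2 - z in nDu.
have [x0 [Dx0 sep]] : exists x, D x /\ forall z, D z -> dot (u - x) (z - x) <= 0.
  by apply: nearest_point => //; exists q.
set d := u - x0 in sep.
have d0 : d != 0 by rewrite subr_eq0; apply/eqP => ux0; apply: nDu; rewrite ux0.
have fd : dot f d = 0.
  by rewrite /d /u mulr2n !dot_lin (fD _ Dz) (fD _ Dx0); ring.
have dE : d = u - x0 by [].
clearbody d.
have [k [k0 fk dk]] := exists_orthogonal2 f d n2.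
have {diam} /choice [AB diam] : forall w, exists ab : 'rV[R]_n * 'rV[R]_n,
    exists s : R, [/\ D ab.1, D ab.2, s *: ab.1 + (1 - s) *: ab.2 = q &
         forall x, D x -> dot w ab.2 <= dot w x /\ dot w x <= dot w ab.1].
  by move=> w; have [a [b [s ?]]] := diam w; exists (a, b), s.
pose X w := (AB w).1 - q; pose Y w := q - (AB w).2.
have XD w x : D x -> dot w (x - q) <= dot w (X w).
  by move=> Dx; have [s [_ _ _ /(_ x Dx)[_ ]]] := diam w; rewrite !dot_lin; lra.
have YD w x : D x -> dot w (q - x) <= dot w (Y w).
  by move=> Dx; have [s [_ _ _ /(_ x Dx)[+ _]]] := diam w; rewrite !dot_lin; lra.
have Xmax w v : dot w (X v) <= dot w (X w) by apply: XD; have [s []] := diam v.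
have Ymax w v : dot w (Y v) <= dot w (Y w) by apply: YD; have [s []] := diam v.
have XY w : dot w (Y w) *: X w = dot w (X w) *: Y w.
  have [s [_ _ sq _]] := diam w.
  have sXY : s *: X w = (1 - s) *: Y w.
    by apply/rowP => i; have /rowP/(_ i) := sq; rewrite !mxE; lra.
  have [s0|s0] := eqVneq s 0.
    have -> : Y w = 0 by move: sXY; rewrite s0 scale0r subr0 scale1r.
    by rewrite dotC dot0l scale0r scaler0.
  have -> : X w = ((1 - s) / s) *: Y w.
    by rewrite mulrC -scalerA -sXY scalerA mulVf // scale1r.
  by rewrite dotZr !scalerA mulrC.
(* Both forms, hence all forms between them, take the same positive value at [e]; as [q + e] and
   [q - e] lie in [D], it bounds both support functions from below. *)
have ratio w0 w1 e : D (q + e) -> D (q - e) -> 0 < dot w0 e -> dot w1 e = dot w0 e ->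
    dot w0 (X w0) / dot w0 (Y w0) <= dot w1 (X w1) / dot w1 (Y w1).
  move=> De Dne e0 e1; apply: (support_ratio_le Xmax Ymax XY e0) => s _ _.
  set w := _ + _; have we : dot w e = dot w0 e by rewrite /w !dot_lin e1; ring.
  have := XD w _ De; have := YD w _ Dne.
  by rewrite addrAC subrr add0r opprB addrC subrK we.
(* Dual vectors: [k] and [d] are 1 at [k' + d'], while [k] and [- d] are 1 at [k' - d']. *)
pose k' := (dot k k)^-1 *: k; pose d' := (dot d d)^-1 *: d.
have kk : dot k k' = 1 by rewrite dotZr mulVf // dot_eq0.
have dd : dot d d' = 1 by rewrite dotZr mulVf // dot_eq0.
have kd : dot k d' = 0 by rewrite dotZr dotC dk mulr0.
have dk' : dot d k' = 0 by rewrite dotZr dk mulr0.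
have [|c1 [c10 De1 Dne1]] := intD (k' + d').
  by rewrite dotDr !dotZr fk fd !mulr0 addr0.
have [|c2 [c20 De2 Dne2]] := intD (k' - d').
  by rewrite dotDr dotNr !dotZr fk fd !mulr0 subr0.
clearbody k' d'.
have r1 : dot k (X k) / dot k (Y k) <= dot d (X d) / dot d (Y d).
  by apply: (ratio _ _ (c1 *: (k' + d'))) => //; rewrite !dot_lin ?kk ?dd ?kd ?dk'; lra.
have r2 : dot (- d) (X (- d)) / dot (- d) (Y (- d)) <= dot k (X k) / dot k (Y k).
  apply: (ratio _ _ (c2 *: (k' - d'))) => //;
  by rewrite !dot_lin ?kk ?dd ?kd ?dk'; lra.
have := le_trans r2 r1.
have gd : 0 < dot d (Y d).
  have := YD d _ Dne1; rewrite opprB addrC subrK !dot_lin dd dk'; lra.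
have gnd : 0 < dot (- d) (Y (- d)).
  have := YD (- d) _ Dne2; rewrite opprB addrC subrK !dot_lin dd dk'; lra.
(* On [D] the form [d] is at most [dot d x0], less than its value at [u], the reflection of [z] in
   [q]; so it extends less beyond [q] than on the side of [z]. *)
have hd : dot d (X d) < dot d (Y d).
  have := YD d _ Dz; have [s [Da _ _ _]] := diam d; have := sep _ Da.
  have : 0 < dot d d by rewrite dot_gt0.
  have -> : dot d d = dot d (q - z) + dot d q - dot d x0.
    by rewrite {2}dE /u mulr2n !dot_lin; ring.
  by rewrite /X !dot_lin; lra.
have h1 : dot d (Y d) <= dot (- d) (X (- d)).
  have [s [_ Db _ _]] := diam d; have := XD (- d) _ Db.
  by rewrite /Y !dot_lin; lra.
have h2 : dot (- d) (Y (- d)) <= dot d (X d).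
  have [s [_ Db _ _]] := diam (- d); have := XD d _ Db.
  by rewrite {1}/Y !dot_lin; lra.
(* With h and g the two support functions, g(d)^2 <= h(-d) g(d) <= h(d) g(-d) <= h(d)^2, against
   h(d) < g(d). *)
rewrite ler_pdivrMr // mulrAC ler_pdivlMr //; nra.
Qed.

End AffineDiameters.

(** * Centers of symmetry, and scaling along rays *)

Section Centers.
Variables (R : realType) (n : nat).
Implicit Types (A B C : set 'rV[R]_n) (p x : 'rV[R]_n).

Lemma center_of_symmetryP C p :
  center_of_symmetry C p <-> C p /\ forall x, C x -> C (p *+ 2 - x).
Proof.
split=> [[Cp CE]|[Cp CE]]; split=> //.
  by move=> x Cx; rewrite CE; exists x.
apply/seteqP; split=> [x Cx|_ [x Cx <-]]; last exact: CE.
by exists (p *+ 2 - x); [exact: CE|rewrite subKr].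
Qed.

(** The two reflections compose to a translation by twice the difference of the centers, which moves
    a maximizer of [dot d] too far unless it is 0. *)
Lemma compact_center_unique C p1 p2 : compact C ->
  center_of_symmetry C p1 -> center_of_symmetry C p2 -> p1 = p2.
Proof.
move=> cC /center_of_symmetryP[Cp1 C1] /center_of_symmetryP[Cp2 C2].
set d := p1 - p2.
have [|x [Cx xmax]] := compact_max _ cC (@continuous_dotr _ _ d); first by exists p1.
have := xmax _ (C1 _ (C2 _ Cx)).
have -> : p1 *+ 2 - (p2 *+ 2 - x) = x + 2 *: d.
  by apply/rowP => i; rewrite !mxE; ring.
rewrite dotDr dotZr => dd; apply/eqP; rewrite -subr_eq0 -dot_eq0 -/d.
by rewrite eq_le dot_ge0 andbT; lra.
Qed.

(** A positive multiple of [x] lies halfway between [- x0] and a point of [B] slightly beyond an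
    interior point [x0] in the direction [x]. *)
Lemma symmetric_convex_absorbing B x : convex_set B -> (forall x, B x -> B (- x)) ->
  interior B !=set0 -> exists c : R, 0 < c /\ B (c *: x).
Proof.
move=> /convex_setP cB BN [x0 Bx0].
have c0 : (fun c : R => x0 + c *: x) @ 0 --> x0 + 0 *: x.
  by apply: cvgD; [exact: cvg_cst|apply: cvgZ; [exact: cvg_id|exact: cvg_cst]].
rewrite scale0r addr0 in c0.
have /nbhs_ballP[e /= e0 eB] := c0 _ Bx0.
have Be : B (x0 + (e / 2) *: x).
  by apply: eB; rewrite /= /ball /= sub0r normrN gtr0_norm; lra.
exists (e / 4); split; first by lra.
have := cB _ _ 2^-1 Be (BN _ (nbhs_singleton Bx0)).
rewrite invr_ge0 ler0n => /(_ isT); rewrite invf_le1 ?ltr0n // ler1n => /(_ isT).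
by congr (B _); apply/rowP => i; rewrite !mxE; field.
Qed.

Lemma closed_ray_limit B x : closed B ->
  (forall s : R, 0 < s -> s < 1 -> B (s *: x)) -> B x.
Proof.
move=> cB Bs.
have cS : compact (`[0, 1] `&` [set s : R | B (s *: x)]).
  apply: compact_closedI; first exact: segment_compact.
  apply: (@closed_preimage R 'rV[R]_n (fun s => s *: x)) => // s.
  by apply: cvgZ; [exact: cvg_id|exact: cvg_cst].
have [||s [[]]] := compact_max _ cS (g := id).
- by exists 2^-1; split; [rewrite /= in_itv /=; lra|apply: Bs; lra].
- by move=> s; exact: cvg_id.
rewrite /= in_itv /= => /andP[s0 s1] Bsx smax.
have [s1'|s1'] := ltP s 1; last by rewrite -(scale1r x); have -> : 1 = s by lra.
suff : (1 + s) / 2 <= s by lra.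
by apply: smax; split; [rewrite /= in_itv /=; lra|apply: Bs; lra].
Qed.

End Centers.

(** * Reflection of each section in a multiple of [p] *)

Section Sections.
Variables (R : realType) (n : nat) (B : set 'rV[R]_n).
Hypotheses (n2 : (2 < n)%N) (Bcompact : compact B) (Bconvex : convex_set B).
Hypothesis Bopp : forall x, B x -> B (- x).
Hypothesis Babs : forall x, exists c : R, 0 < c /\ B (c *: x).
Hypothesis Bpark : forall C : set 'rV[R]_n,
  C !=set0 -> closed C -> convex_set C -> C `<=` B -> parkable B C.
Variables (f p : 'rV[R]_n).
Hypotheses (Bp : B p) (pmax : forall x, B x -> dot f x <= dot f p).
Let T := dot f p.

Let Bcomb : forall x y (s : R), B x -> B y -> 0 <= s -> s <= 1 ->
  B (s *: x + (1 - s) *: y) := (convex_setP B).1 Bconvex.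

(** Below the top level, [q] is a proper mixture of [p] and 0, so the room of [B] around 0 leaves
    room around [q] within its level. *)
Lemma interior_section_reflection y : B y -> 0 < dot f y -> dot f y < T ->
  B (((dot f y / T) *: p) *+ 2 - y).
Proof.
set t := dot f y => By t0 tT.
have T0 : 0 < T by lra.
have tT0 : 0 <= t / T by rewrite divr_ge0 // ltW.
have tT1 : t / T < 1 by rewrite ltr_pdivrMr // mul1r.
have B0 : B 0 by have [c [_]] := Babs 0; rewrite scaler0.
set q := (t / T) *: p.
have fq : dot f q = t by rewrite dotZr -/T divfK //; lra.
pose D := B `&` [set x | dot f x = t].
suff : D (q *+ 2 - y) by case.
apply: (@affine_diameters_center _ _ D q f) => //.
- apply: compact_closedI => //.
  by apply: closed_eq_fun; [exact: continuous_dotr|exact: cst_continuous].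
- apply/convex_setP => x z s [Bx fx] [Bz fz] s0 s1; split; first exact: Bcomb.
  by rewrite /= in fx fz *; rewrite !dot_lin fx fz; ring.
- split=> //; rewrite /q -[_ *: p]addr0 -(scaler0 _ (1 - t / T)).
  by apply: Bcomb => //; exact: ltW.
- by move=> x [_ fx]; rewrite fq.
- move=> z fz; have [c [c0 Bc]] := Babs z.
  have Dq e : B e -> dot f e = 0 -> D (q + (1 - t / T) *: e).
    move=> Be fe; split; first by apply: Bcomb => //; exact: ltW.
    by rewrite /= dotDr fq dotZr fe mulr0 addr0.
  exists ((1 - t / T) * c); split.
  + by rewrite mulr_gt0 // subr_gt0.
  + by rewrite -scalerA; apply: Dq => //; rewrite dotZr fz mulr0.
  + rewrite -scalerA -scalerN; apply: Dq; first exact: Bopp.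
    by rewrite dotNr dotZr fz mulr0 oppr0.
- move=> w; have [a [b [s [s0 s1 sq [Ba [fa amax]] [Bb [fb bmin]]]]]] :=
    extremal_chord Bcompact Bconvex Bopp Bpark w Bp pmax t0 (ltW tT).
  exists a, b, s; split=> // x [Bx fx].
  by split; [exact: bmin|exact: amax].
Qed.

(** The top level is a limit, as [s *: z] lies below it for s < 1; the symmetry of [B] settles level
    0 and carries positive levels to negative ones. *)
Lemma section_reflection y : 0 < T -> B y -> B (((dot f y / T) *: p) *+ 2 - y).
Proof.
move=> T0.
have Bclosed := rV_compact_closed Bcompact.
have B0 : B 0 by have [c [_]] := Babs 0; rewrite scaler0.
have pos z : B z -> 0 < dot f z -> B (((dot f z / T) *: p) *+ 2 - z).
  move=> Bz fz; apply: closed_ray_limit => // s s0 s1.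
  have sz : B (s *: z).
    by rewrite -[_ *: z]addr0 -(scaler0 _ (1 - s)); apply: Bcomb => //; exact: ltW.
  have zT : dot f z <= T by exact: pmax.
  have := interior_section_reflection sz; rewrite dotZr => /(_ _ _)H.
  rewrite scalerBr -scalerMnr scalerA mulrA; apply: H; nra.
move=> By; have [fy|fy|fy] := ltgtP (dot f y) 0.
- have := pos _ (Bopp By); rewrite dotNr oppr_gt0 => /(_ fy) /Bopp.
  by rewrite mulNr scaleNr mulNrn opprB opprK addrC.
- exact: pos.
- by rewrite fy mul0r scale0r mul0rn sub0r; exact: Bopp.
Qed.

End Sections.

(** * Hyperplane sections as levels of a form, and the line of their centers *)

Theorem proposition9 (R : realType) (n : nat) (B : set 'rV[R]_n) :
  (2 < n)%N ->
  convex_body B ->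
  centrally_symmetric B ->
  (forall C : set 'rV[R]_n,
     C !=set0 -> closed C -> convex_set C -> C `<=` B -> parkable B C) ->
  forall H : {vspace 'rV[R]_n}, linear_hyperplane H ->
    (forall x : 'rV[R]_n, hyperplane_section H B x !=set0 ->
       exists p : 'rV[R]_n, center_of_symmetry (hyperplane_section H B x) p)
    /\ collinear [set p | exists x : 'rV[R]_n,
         hyperplane_section H B x !=set0
         /\ center_of_symmetry (hyperplane_section H B x) p].
Proof.
move=> n2 [cB cvB intB B0] [_ /center_of_symmetryP[_ sB]] park H dimH.
have Bopp x : B x -> B (- x) by move=> /sB; rewrite mul0rn sub0r.
have Babs x : exists c : R, 0 < c /\ B (c *: x).
  exact: symmetric_convex_absorbing.
have [f [f0 Hf]] := hyperplane_normal (ltnW (ltnW n2)) dimH.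
have [|p [Bp pmax]] := compact_max _ cB (@continuous_dotr _ _ f); first by exists 0.
set T := dot f p in pmax.
have T0 : 0 < T.
  have [c [c0 /pmax]] := Babs f; rewrite dotZr; apply: lt_le_trans.
  by rewrite mulr_gt0 // dot_gt0.
have secE x : hyperplane_section H B x = B `&` [set y | dot f y = dot f x].
  apply/seteqP; split=> y.
    move=> [[h /= hH <-] By]; split=> //=.
    by move: hH; rewrite Hf dotDr => /eqP ->; rewrite add0r.
  move=> [By /= fy]; split=> //; exists (y - x); last by rewrite subrK.
  by rewrite /= Hf dotDr dotNr fy subrr.
have sec_center x : hyperplane_section H B x !=set0 ->
    center_of_symmetry (hyperplane_section H B x) ((dot f x / T) *: p).
  rewrite secE => -[y [By /= fy]]; rewrite -fy.
  have refl z := section_reflection n2 cB cvB Bopp Babs park Bp pmax T0 (y := z).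
  have fE : dot f ((dot f y / T) *: p) = dot f y by rewrite dotZr -/T divfK ?gt_eqF.
  apply/center_of_symmetryP; split.
    (* The candidate is the midpoint of [y] and its reflection, so convexity puts it in [B]. *)
    split=> //; have := (convex_setP B).1 cvB _ _ 2^-1 By (refl y By).
    rewrite invr_ge0 ler0n => /(_ isT); rewrite invf_le1 ?ltr0n // ler1n => /(_ isT).
    by congr (B _); apply/rowP => i; rewrite !mxE; field; rewrite gt_eqF.
  move=> z [Bz /= fz]; split; first by rewrite -fz; exact: refl.
  by rewrite /= mulr2n dotDr dotNr dotDr fE fz addrK.
split=> [x /sec_center ?|]; first by eexists; eassumption.
exists 0, p; split; first by apply: contraTneq T0 => p0; rewrite /T p0 dotC dot0l ltxx.
(* By uniqueness, any center of a section is the multiple of [p] found above. *)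
move=> c [x [nx cx]]; exists (dot f x / T) => //.
rewrite add0r; apply: compact_center_unique (sec_center x nx) cx.
rewrite secE; apply: compact_closedI => //.
by apply: closed_eq_fun; [exact: continuous_dotr|exact: cst_continuous].
Qed.
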